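(* Consider the semi-random corruption model with corruption probability $p$. Suppose that $r_{\bar x},r_{\bar y},r_{\bar z}$ are positive constants (independent of $n,m,l$) satisfying $r_{\bar x}=r_{\bar y}=r_{\bar z}$ and let $r_{\bar w}:=r_{\bar x}r_{\bar y}r_{\bar z}$. Assume that, as $n,m,l\to\infty$, the six quantities $n\exp(-m)$, $n\exp(-l)$, $m\exp(-n)$, $m\exp(-l)$, $l\exp(-n)$, $l\exp(-m)$ all tend to $0$. If $p$ is a constant satisfying $$p<\frac{r_{\bar w}}{2(1+r_{\bar w})},$$ then the standard LP (sLP) recovers the ground truth with high probability.
   Context: Write $[n]=\{1,\dots,n\}$. For vectors $x\in\mathbb R^n,y\in\mathbb R^m,z\in\mathbb R^l$, $x\otimes y\otimes z$ is the $n\times m\times l$ tensor with $(i,j,k)$ entry $x_iy_jz_k$. Fully-random corruption model: fix $\bar x\in\{0,1\}^n$, $\bar y\in\{0,1\}^m$, $\bar z\in\{0,1\}^l$; the ground truth is $\bar{\mathcal W}=\bar x\otimes\bar y\otimes\bar z$. Given $p\in[0,1]$, the random noisy binary tensor $\mathcal G=(g_{ijk})$ is obtained by corrupting each entry independently: $g_{ijk}=1-\bar x_i\bar y_j\bar z_k$ with probability $p$ and $g_{ijk}=\bar x_i\bar y_j\bar z_k$ with probability $1-p$. Semi-random corruption model: first $\mathcal G$ is generated by the fully-random model; then an adversary modifies $\mathcal G$ by an arbitrary sequence of monotone transformations, i.e. the adversary may choose any set of corrupted entries (entries where $\mathcal G$ differs from $\bar{\mathcal W}$) and revert them to their values in $\bar{\mathcal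 W}$. The resulting tensor is the input of the optimization problem. $r_{\bar x}$ (resp. $r_{\bar y}$, $r_{\bar z}$) is the ratio of the number of ones in $\bar x$ (resp. $\bar y$, $\bar z$) to its number of entries. Given an input binary tensor $\mathcal G=(g_{ijk})$, let $S_0=\{(i,j,k)\in[n]\times[m]\times[l]:g_{ijk}=0\}$ and $S_1=\{(i,j,k)\in[n]\times[m]\times[l]:g_{ijk}=1\}$. The standard LP (sLP), in variables $x\in\mathbb R^n,y\in\mathbb R^m,z\in\mathbb R^l,\mathcal W=(w_{ijk})\in\mathbb R^{n\times m\times l}$, is $$\begin{aligned}\min\ &\sum_{(i,j,k)\in S_0}w_{ijk}+\sum_{(i,j,k)\in S_1}(1-w_{ijk})\\ \text{s.t. }& w_{ijk}\le x_i,\ w_{ijk}\le y_j,\ w_{ijk}\le z_k,\quad\forall(i,j,k)\in S_1,\\ & w_{ijk}\ge0,\ w_{ijk}\ge x_i+y_j+z_k-2,\quad\forall(i,j,k)\in S_0,\\ &(x,y,z)\in[0,1]^{n+m+l}.\end{aligned}$$ It recovers the ground truth if it has a unique optimal solution and this solution is $(\bar x,\bar y,\bar z,\bar{\mathcal W})$. ''With high probability'' means with probability tending to $1$ as $n,m,l\to\infty$ (along a family of instances whose three dimensions all go to infinity). *)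

(* Defs.v *)
From HB Require Import structures.
From mathcomp Require Import all_boot all_order all_algebra.
From mathcomp Require Import all_classical all_reals all_analysis.

Set Implicit Arguments.
Unset Strict Implicit.
Unset Printing Implicit Defensive.

Import Order.TTheory GRing.Theory Num.Theory.
Import numFieldNormedType.Exports.

Local Open Scope ring_scope.

Notation vec T n := {ffun 'I_n -> T}.
Notation entry n m l := ('I_n * 'I_m * 'I_l)%type.
Notation tensor T n m l := {ffun entry n m l -> T}.

(* Binary vectors and tensors take values in bool; they are embedded in R only
   where they occur as points of the linear program. *)
Definition real_ffun (R : realType) (I : finType) (f : {ffun I -> bool}) :
  {ffun I -> R} := [ffun i => (f i)%:R].

Definition ratio_ones (R : realType) n (x : vec bool n) : R :=
  #|[set i | x i]|%:R / n%:R.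

Definition ground_truth n m l (x : vec bool n) (y : vec bool m)
    (z : vec bool l) : tensor bool n m l :=
  [ffun e => [&& x e.1.1, y e.1.2 & z e.2]].

Definition corrupted n m l (W G : tensor bool n m l) : {set entry n m l} :=
  [set e | G e != W e].

(* Probability that the fully-random model with ground truth W and corruption
   probability p outputs G: a product over the independent entries. *)
Definition fully_random_mass (R : realType) n m l (p : R)
    (W G : tensor bool n m l) : R :=
  \prod_(e : entry n m l) (if G e == W e then 1 - p else p).

Definition revert n m l (W G : tensor bool n m l) (B : {set entry n m l}) :
    tensor bool n m l :=
  [ffun e => if e \in B then W e else G e].

(* An adversary sees the whole corrupted tensor G and selects the set of
   corrupted entries to be reverted. *)
Definition adversary n m l := tensor bool n m l -> {set entry n m l}.

Definition monotone_adversary n m l (W : tensor bool n m l)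
    (A : adversary n m l) : Prop :=
  forall G, A G \subset corrupted W G.

(* Probability that the output of the semi-random model satisfies E. *)
Definition semi_random_prob (R : realType) n m l (p : R)
    (W : tensor bool n m l) (A : adversary n m l)
    (E : tensor bool n m l -> Prop) : R :=
  \sum_(G : tensor bool n m l | `[< E (revert W G (A G)) >])
     fully_random_mass p W G.

Section StandardLP.
Variables (R : realType) (n m l : nat).

Record lp_point := LPPoint {
  lp_x : vec R n;
  lp_y : vec R m;
  lp_z : vec R l;
  lp_w : tensor R n m l }.

Implicit Types (G : tensor bool n m l) (s : lp_point).

Definition S0 G : {set entry n m l} := [set e | ~~ G e].
Definition S1 G : {set entry n m l} := [set e | G e].

Definition sLP_objective G s : R :=
  \sum_(e in S0 G) lp_w s e + \sum_(e in S1 G) (1 - lp_w s e).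

Definition sLP_feasible G s : Prop :=
  [/\ forall i j k, (i, j, k) \in S1 G ->
        [/\ lp_w s (i, j, k) <= lp_x s i,
            lp_w s (i, j, k) <= lp_y s j &
            lp_w s (i, j, k) <= lp_z s k],
      forall i j k, (i, j, k) \in S0 G ->
        0 <= lp_w s (i, j, k) /\
        lp_x s i + lp_y s j + lp_z s k - 2 <= lp_w s (i, j, k),
      forall i, 0 <= lp_x s i <= 1,
      forall j, 0 <= lp_y s j <= 1 &
      forall k, 0 <= lp_z s k <= 1].

Definition sLP_optimal G s : Prop :=
  sLP_feasible G s /\
  forall s', sLP_feasible G s' -> sLP_objective G s <= sLP_objective G s'.

Definition truth_point (x : vec bool n) (y : vec bool m) (z : vec bool l) :
    lp_point :=
  LPPoint (real_ffun R x) (real_ffun R y) (real_ffun R z)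
          (real_ffun R (ground_truth x y z)).

Definition sLP_recovers (x : vec bool n) (y : vec bool m) (z : vec bool l) G :
    Prop :=
  sLP_optimal G (truth_point x y z) /\
  forall s, sLP_optimal G s -> s = truth_point x y z.

End StandardLP.

(* Main.v *)
Require Import Defs.
From HB Require Import structures.
From mathcomp Require Import all_boot all_order all_algebra.
From mathcomp Require Import all_classical all_reals all_analysis.
From mathcomp Require Import ring lra.

Set Implicit Arguments.
Unset Strict Implicit.
Unset Printing Implicit Defensive.

Import Order.TTheory GRing.Theory Num.Theory.
Import numFieldNormedType.Exports.

(** Measure a feasible point by its gaps a_i, b_j, c_k: the distances of its
    coordinates x_i, y_j, z_k to the ground truth.  The excess of its objective
    over that of the ground truth is a sum over entries, and each summand is at
    least a linear form in the three gaps of the entry.  The coefficients of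
    that form ([weight]) depend only on the three true bits and on whether the
    random corruption hit the entry ([entry_lower_bound]).  Summing over
    entries, the excess is at least
      sum_i slope_x i * a_i + sum_j slope_y j * b_j + sum_k slope_z k * c_k,
    where a slope is the sum of the weights over one slice of the tensor.  If
    all slopes are positive, the ground truth is the unique optimum
    ([positive_slopes_recover]).

    The adversary is harmless because the linear form of a corrupted entry
    bounds its summand also after the entry has been reverted; so the slopes of
    the tensor before reversal certify recovery after it.

    The weights contain one free parameter la in [0, 1], used at uncorrupted
    entries with exactly one zero bit: there, with a the gap at the zero bit,
    w >= 0 and w >= a - b - c give w >= la * (a - b - c).  A larger la helps
    the slopes at zero bits and hurts those at one bits.  A value for which both
    kinds have positive mean exists as soon as 2 p (1 + r^3) < r^3, which is the
    threshold of the theorem ([mean_slopes_positive]).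

    A slope is a sum of independent bounded variables, as many as its slice has
    entries, with mean at least c > 0 per entry.  By the exponential moment
    method ([product_chernoff]) it fails to be positive with probability at most
    exp (- de * m * l) for a slice fixing a coordinate of x, where
    de = c^2 / 8.  The union bound adds up to
      n exp (- de m l) + m exp (- de n l) + l exp (- de n m),
    and once all dimensions are at least 1 / de, each term is at most one of
    the quantities assumed to vanish. *)

Local Open Scope ring_scope.

(** * Sums over entries and slices *)

Section Sums.
Variables (V : nmodType) (n m l : nat).
Implicit Types F : entry n m l -> V.

Lemma sum_entry_x F : \sum_e F e = \sum_i \sum_j \sum_k F (i, j, k).
Proof.
rewrite (eq_bigr (fun e => F (e.1, e.2))); last by case.
rewrite -(pair_bigA _ (fun e k => F (e, k))) /=.
rewrite (eq_bigr (fun e => \sum_k F (e.1, e.2, k))); last by case.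
by rewrite -(pair_bigA _ (fun i j => \sum_k F (i, j, k))).
Qed.

Lemma sum_entry_y F : \sum_e F e = \sum_j \sum_i \sum_k F (i, j, k).
Proof. by rewrite sum_entry_x exchange_big. Qed.

Lemma sum_entry_z F : \sum_e F e = \sum_k \sum_i \sum_j F (i, j, k).
Proof.
rewrite sum_entry_x (eq_bigr _ (fun i _ => exchange_big _ _ _ _ _ _)) /=.
by rewrite exchange_big.
Qed.

Lemma sum_slice_x F i0 :
  \sum_(e | e.1.1 == i0) F e = \sum_j \sum_k F (i0, j, k).
Proof.
rewrite big_mkcond sum_entry_x /= (bigD1 i0) //= eqxx.
rewrite [X in _ + X]big1 ?addr0 // => i ne_i.
by rewrite (negPf ne_i) big1 // => j _; rewrite big1.
Qed.

Lemma sum_slice_y F j0 :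
  \sum_(e | e.1.2 == j0) F e = \sum_i \sum_k F (i, j0, k).
Proof.
rewrite big_mkcond sum_entry_y /= (bigD1 j0) //= eqxx.
rewrite [X in _ + X]big1 ?addr0 // => j ne_j.
by rewrite (negPf ne_j) big1 // => i _; rewrite big1.
Qed.

Lemma sum_slice_z F k0 :
  \sum_(e | e.2 == k0) F e = \sum_i \sum_j F (i, j, k0).
Proof.
rewrite big_mkcond sum_entry_z /= (bigD1 k0) //= eqxx.
rewrite [X in _ + X]big1 ?addr0 // => k ne_k.
by rewrite (negPf ne_k) big1 // => i _; rewrite big1.
Qed.
End Sums.

Lemma sum_by_ratio (R : realType) n (x : vec bool n) (f : bool -> R) :
  \sum_i f (x i) =
  n%:R * (ratio_ones R x * f true + (1 - ratio_ones R x) * f false).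
Proof.
have [n0|n_gt0] := posnP n; first by subst n; rewrite big_ord0 mul0r.
have n_neq0 : n%:R != 0 :> R by rewrite pnatr_eq0 -lt0n.
have card0 : #|[set i | ~~ x i]|%:R = n%:R - #|[set i | x i]|%:R :> R.
  apply/eqP; rewrite eq_sym subr_eq -natrD eqr_nat addnC.
  have := cardsC [set i | x i]; rewrite card_ord => {1}<-; rewrite eqn_add2l.
  by apply/eqP/eq_card => i; rewrite !inE.
rewrite (bigID (fun i => x i)) /= (eq_bigr (fun=> f true)); last by move=> i ->.
rewrite [X in _ + X](eq_bigr (fun=> f false)); last by move=> i /negPf ->.
rewrite !sumr_const -[X in X + _]mulr_natr -[X in _ + X]mulr_natr.
rewrite -[X in f true * X%:R]cardsE -[X in f false * X%:R]cardsE.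
by rewrite card0 /ratio_ones; field.
Qed.

(** * Tail bound for independent bits, and union bound *)

(** Inverting 1 - y <= exp (- y) gives exp y <= 1 / (1 - y), and on this range
    the right-hand side is below a quadratic. *)
Lemma expR_le_quad (R : realType) (y : R) :
  `|y| <= 2^-1 -> expR y <= 1 + y + 2 * y ^+ 2.
Proof.
rewrite ler_norml => /andP[y_ge y_le].
have y1 : 0 < 1 - y by lra.
have : expR y <= (1 - y)^-1.
  rewrite -[y in expR y]opprK expRN lef_pV2 ?posrE ?expR_gt0 //.
  exact: expR_ge1Dx.
move=> /le_trans; apply; rewrite -[_^-1]mul1r ler_pdivrMr //.
have : 0 <= y ^+ 2 * (1 - 2 * y) by rewrite mulr_ge0 ?sqr_ge0 //; lra.
by lra.
Qed.

Lemma mgf_bounded (R : realType) (t v : R) : 0 <= t <= 2^-1 -> `|v| <= 1 ->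
  expR (- t * v) <= 1 - t * v + 2 * t ^+ 2.
Proof.
move=> /andP[t_ge0 t_le] v1.
have /expR_le_quad/le_trans : `|- t * v| <= 2^-1.
  rewrite normrM normrN (ger0_norm t_ge0).
  by apply: (le_trans _ t_le); rewrite ler_piMr.
apply; rewrite exprMn sqrrN mulNr.
have v2 : v ^+ 2 <= 1 by rewrite -real_normK ?num_real // expr_le1.
by have := ler_wpM2l (sqr_ge0 t) v2; lra.
Qed.

Section ProductMeasure.
Variables (R : realType) (I : finType) (W : {ffun I -> bool}) (p : R).
Hypotheses (p_ge0 : 0 <= p) (p_le1 : p <= 1).

Local Notation mass G := (\prod_e (if G e == W e then 1 - p else p)).

Lemma mass_ge0 (G : {ffun I -> bool}) : 0 <= mass G.
Proof.
by apply: prodr_ge0 => e _; case: ifP => // _; rewrite subr_ge0.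
Qed.

(** Independence: the expectation of a product of functions of distinct entries
    is the product of their expectations. *)
Lemma expectation_prod (h : I -> bool -> R) :
  \sum_(G : {ffun I -> bool}) mass G * \prod_e h e (G e == W e) =
  \prod_e ((1 - p) * h e true + p * h e false).
Proof.
pose F e b := (if b == W e then 1 - p else p) * h e (b == W e).
rewrite (eq_bigr (fun G : {ffun _} => \prod_e F e (G e))); last first.
  by move=> G _; rewrite -big_split.
rewrite -bigA_distr_bigA; apply: eq_bigr => e _.
by rewrite big_bool /F; case: (W e) => //=; rewrite addrC.
Qed.

Lemma mass_total : \sum_(G : {ffun I -> bool}) mass G = 1.
Proof.
have := expectation_prod (fun _ _ => 1).
rewrite (eq_bigr (fun G : {ffun _} => mass G)); last first.
  by move=> G _; rewrite [X in _ * X]big1 ?mulr1.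
by move=> ->; apply: big1 => e _; lra.
Qed.

(** Markov's inequality for exp (- t * sum phi), whose expectation factorizes by
    independence; each factor is at most exp (- t * mean + 2 * t^2).  The
    exponent - t c + 2 t^2 per term is least at t = c / 4, where it equals
    - c^2 / 8. *)
Lemma product_chernoff (P : pred I) (phi : I -> bool -> R) (c : R) :
  (forall e b, `|phi e b| <= 1) -> 0 <= c <= 1 ->
  c * #|P|%:R <= \sum_(e | P e) ((1 - p) * phi e true + p * phi e false) ->
  \sum_(G : {ffun I -> bool} | \sum_(e | P e) phi e (G e == W e) <= 0) mass G
    <= expR (- (c ^+ 2 / 8 * #|P|%:R)).
Proof.
move=> phi1 c01 mean; pose t := c / 4.
have t_ge0 : 0 <= t by rewrite /t; lra.
pose h e b := if P e then expR (- t * phi e b) else 1.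
have hE (G : {ffun I -> bool}) : \prod_e h e (G e == W e) =
    expR (- t * \sum_(e | P e) phi e (G e == W e)).
  by rewrite -big_mkcond /= mulr_sumr -expR_sum.
apply: (@le_trans _ _ (\sum_(G : {ffun I -> bool}) mass G *
    \prod_e h e (G e == W e))).
  rewrite big_mkcond /=; apply: ler_sum => G _; rewrite hE.
  have mG := mass_ge0 G; case: ifP => [neg|_]; last first.
    by rewrite mulr_ge0 ?expR_ge0.
  by rewrite ler_peMr // -expR0 ler_expR mulNr -mulrN mulr_ge0 // oppr_ge0.
pose mu e := (1 - p) * phi e true + p * phi e false.
rewrite expectation_prod (@le_trans _ _
    (\prod_(e | P e) expR (- t * mu e + 2 * t ^+ 2))) //.
  rewrite [leRHS]big_mkcond /=; apply: ler_prod => e _.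
  rewrite /h; case: ifP => _; last by lra.
  have p0 : 0 <= 1 - p by rewrite subr_ge0.
  rewrite addr_ge0 ?mulr_ge0 ?expR_ge0 //=.
  have quad b : expR (- t * phi e b) <= 1 - t * phi e b + 2 * t ^+ 2.
    by apply: mgf_bounded => //; rewrite /t; lra.
  have Ht := ler_wpM2l p0 (quad true).
  have Hf := ler_wpM2l p_ge0 (quad false).
  apply: le_trans (expR_ge1Dx _); rewrite /mu; lra.
rewrite -expR_sum ler_expR big_split /= -mulr_sumr sumr_const -/mu.
rewrite -mulr_natr.
have : t * (c * #|P|%:R) <= t * \sum_(e | P e) mu e by rewrite ler_wpM2l.
rewrite /t; lra.
Qed.
End ProductMeasure.

Lemma union_bound (R : realType) (I J : finType) (F : pred J)
    (B : I -> pred J) (mu : J -> R) (b : I -> R) :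
  (forall g, 0 <= mu g) ->
  (forall g, F g -> exists i, B i g) ->
  (forall i, \sum_(g | B i g) mu g <= b i) ->
  \sum_(g | F g) mu g <= \sum_i b i.
Proof.
move=> mu_ge0 cover Bb.
apply: (@le_trans _ _ (\sum_i \sum_(g | B i g) mu g)); last exact: ler_sum.
rewrite (eq_bigr (fun i => \sum_g if B i g then mu g else 0)); last first.
  by move=> i _; rewrite big_mkcond.
rewrite exchange_big big_mkcond /=; apply: ler_sum => g _.
have ge0 i : 0 <= if B i g then mu g else 0 by case: ifP.
case: ifP => [/cover[i Big]|_]; last exact: sumr_ge0.
by rewrite (bigD1 i) //= Big lerDl sumr_ge0.
Qed.

(** * Positive slopes imply recovery *)

(** Coefficient of the gap of one coordinate of an entry in the linear lower
    bound for the excess there.  [own] is the true bit of that coordinate, [o1]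
    and [o2] are those of the two others, [intact] says that the entry is not
    corrupted.  The fractions come from splitting a bound evenly: the excess of
    an intact entry of value 1 is at least the maximum of its gaps, hence at
    least their average; the loss at a corrupted entry of true value 0 is at
    most the minimum of the gaps at its zero bits, hence at most their
    average. *)
Definition weight (R : realType) (la : R) (own o1 o2 intact : bool) : R :=
  match own, o1, o2 with
  | true, true, true => if intact then 3^-1 else -1
  | true, true, false | true, false, true => if intact then - la else 0
  | true, false, false => 0
  | false, true, true => if intact then la else -1
  | false, true, false | false, false, true => if intact then 0 else - 2^-1
  | false, false, false => if intact then 0 else - 3^-1
  end.

(** For v in [0, 1], the distance from v to the bit b. *)
Definition gap (R : realType) (b : bool) (v : R) : R := if b then 1 - v else v.

Lemma weight_bounded (R : realType) (la : R) own o1 o2 b :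
  0 <= la <= 1 -> `|weight la own o1 o2 b| <= 1.
Proof.
by move=> la01; case: own o1 o2 b => [] [] [] []; rewrite ler_norml /=; lra.
Qed.

Lemma gap_ge0 (R : realType) b (v : R) : 0 <= v <= 1 -> 0 <= gap b v.
Proof. by case: b; rewrite /gap; lra. Qed.

Lemma gap_eq0 (R : realType) b (v : R) : gap b v = 0 -> v = b%:R.
Proof. by case: b; rewrite /gap /=; lra. Qed.

Lemma sum_gap_ge0 (R : realType) (I : finType) (c : I -> R) (v : {ffun I -> R})
    (b : {ffun I -> bool}) :
  (forall i, 0 < c i) -> (forall i, 0 <= v i <= 1) ->
  0 <= \sum_i c i * gap (b i) (v i).
Proof.
by move=> c_gt0 v01; apply: sumr_ge0 => i _; rewrite mulr_ge0 ?gap_ge0 // ltW.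
Qed.

Lemma sum_gap_le0 (R : realType) (I : finType) (c : I -> R) (v : {ffun I -> R})
    (b : {ffun I -> bool}) :
  (forall i, 0 < c i) -> (forall i, 0 <= v i <= 1) ->
  \sum_i c i * gap (b i) (v i) <= 0 -> v = real_ffun R b.
Proof.
move=> c_gt0 v01 sum_le0.
have /eqP : \sum_i c i * gap (b i) (v i) = 0.
  by apply/eqP; rewrite eq_le sum_le0 sum_gap_ge0.
rewrite psumr_eq0 => [/allP sum0|i _]; last by rewrite mulr_ge0 ?gap_ge0 // ltW.
apply/ffunP => i; rewrite ffunE; apply/gap_eq0/eqP.
by have := sum0 i (mem_index_enum i); rewrite mulf_eq0 gt_eqF.
Qed.

(** [g] is the entry before the adversary acts, [h] the one that the linear
    program sees.  The weights are those of [g]: if a corrupted entry has been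
    reverted, the excess is nonnegative while the linear form is nonpositive. *)
Lemma entry_lower_bound (R : realType) (la vx vy vz w : R)
    (bx by_ bz g h : bool) :
  let b := [&& bx, by_ & bz] in
  0 <= la <= 1 -> 0 <= vx <= 1 -> 0 <= vy <= 1 -> 0 <= vz <= 1 ->
  (h -> [/\ w <= vx, w <= vy & w <= vz]) ->
  (~~ h -> 0 <= w /\ vx + vy + vz - 2 <= w) ->
  h = g \/ h = b ->
  weight la bx by_ bz (g == b) * gap bx vx +
  weight la by_ bx bz (g == b) * gap by_ vy +
  weight la bz bx by_ (g == b) * gap bz vz <=
  if h then b%:R - w else w - b%:R.
Proof.
move=> b /andP[la0 la1] vx01 vy01 vz01 Hone Hzero hgb.
(* This is where the two constraints on an entry of value 0 are combined
   with weights 1 - la and la. *)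
have scale d : 0 <= w -> d <= w -> la * d <= w by nra.
case: h hgb Hone Hzero => hgb Hone Hzero.
  have {Hone Hzero} [w1 w2 w3] := Hone isT.
  by case: bx by_ bz g @b hgb {scale} => [] [] [] [] /= [] //= _; lra.
have {Hone Hzero} [w0 w1] := Hzero isT.
have S1 := scale _ w0 w1.
by case: bx by_ bz g @b hgb {scale} => [] [] [] [] /= [] //= _; lra.
Qed.

Section Recovery.
Variables (R : realType) (n m l : nat).
Variables (x : vec bool n) (y : vec bool m) (z : vec bool l) (la : R).
Implicit Types (G H : tensor bool n m l) (s : lp_point R n m l).

Local Notation W := (ground_truth x y z).

Lemma truth_feasible H : sLP_feasible H (truth_point R x y z).
Proof.
split=> [i j k _|i j k _|i|j|k]; rewrite /= !ffunE /=.
- by case: (x i) (y j) (z k) => [] [] []; split; rewrite /= ?ler01 ?lexx.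
- by case: (x i) (y j) (z k) => [] [] []; split=> /=; lra.
- by case: (x i) => /=; lra.
- by case: (y j) => /=; lra.
- by case: (z k) => /=; lra.
Qed.

Definition excess H s e : R :=
  if H e then (W e)%:R - lp_w s e else lp_w s e - (W e)%:R.

Lemma objective_excess H s :
  sLP_objective H s - sLP_objective H (truth_point R x y z) =
  \sum_e excess H s e.
Proof.
rewrite /sLP_objective !(big_mkcond (fun e => e \in _)) /= -!big_split -sumrB.
apply: eq_bigr => e _ /=; rewrite !inE !ffunE /excess ffunE.
by case: (H e) => /=; lra.
Qed.

Definition slope_x G i := \sum_j \sum_k
  weight la (x i) (y j) (z k) (G (i, j, k) == W (i, j, k)).
Definition slope_y G j := \sum_i \sum_k
  weight la (y j) (x i) (z k) (G (i, j, k) == W (i, j, k)).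
Definition slope_z G k := \sum_i \sum_j
  weight la (z k) (x i) (y j) (G (i, j, k) == W (i, j, k)).

Definition positive_slopes G :=
  [/\ forall i, 0 < slope_x G i, forall j, 0 < slope_y G j
    & forall k, 0 < slope_z G k].

Lemma excess_slopes G H s : 0 <= la <= 1 ->
  (forall e, H e = G e \/ H e = W e) -> sLP_feasible H s ->
  \sum_i slope_x G i * gap (x i) (lp_x s i) +
  \sum_j slope_y G j * gap (y j) (lp_y s j) +
  \sum_k slope_z G k * gap (z k) (lp_z s k) <= \sum_e excess H s e.
Proof.
move=> la01 HG [H1 H0 Hx Hy Hz].
pose Fx (e : entry n m l) :=
  weight la (x e.1.1) (y e.1.2) (z e.2) (G e == W e) *
  gap (x e.1.1) (lp_x s e.1.1).
pose Fy (e : entry n m l) :=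
  weight la (y e.1.2) (x e.1.1) (z e.2) (G e == W e) *
  gap (y e.1.2) (lp_y s e.1.2).
pose Fz (e : entry n m l) :=
  weight la (z e.2) (x e.1.1) (y e.1.2) (G e == W e) *
  gap (z e.2) (lp_z s e.2).
have -> : \sum_i slope_x G i * gap (x i) (lp_x s i) = \sum_e Fx e.
  rewrite sum_entry_x; apply: eq_bigr => i _; rewrite mulr_suml.
  by apply: eq_bigr => j _; rewrite mulr_suml.
have -> : \sum_j slope_y G j * gap (y j) (lp_y s j) = \sum_e Fy e.
  rewrite sum_entry_y; apply: eq_bigr => j _; rewrite mulr_suml.
  by apply: eq_bigr => i _; rewrite mulr_suml.
have -> : \sum_k slope_z G k * gap (z k) (lp_z s k) = \sum_e Fz e.
  rewrite sum_entry_z; apply: eq_bigr => k _; rewrite mulr_suml.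
  by apply: eq_bigr => i _; rewrite mulr_suml.
rewrite -!big_split; apply: ler_sum => -[[i j] k] _ /=.
rewrite /Fx /Fy /Fz /excess /=.
have WE : W (i, j, k) = [&& x i, y j & z k] by rewrite ffunE.
have := HG (i, j, k); rewrite WE => hgb.
apply: entry_lower_bound => //.
  by move=> h1; apply: H1; rewrite inE.
by move=> h0; apply: H0; rewrite inE.
Qed.

(** Optimality follows from the nonnegativity of the slope bound.  For
    uniqueness, a zero excess forces all gaps to vanish; then x, y, z are the
    true bits, the constraints make every entrywise excess nonnegative, and
    these have sum zero, so that w is determined too. *)
Lemma positive_slopes_recover G H : 0 <= la <= 1 -> positive_slopes G ->
  (forall e, H e = G e \/ H e = W e) -> sLP_recovers R x y z H.
Proof.
move=> la01 [px py pz] HG.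
have bound s (fs : sLP_feasible H s) := excess_slopes la01 HG fs.
split.
  split=> [|s fs]; first exact: truth_feasible.
  rewrite -subr_ge0 objective_excess; apply: le_trans (bound s fs).
  by case: fs => _ _ Hx Hy Hz; rewrite !addr_ge0 ?sum_gap_ge0.
move=> s [fs opt].
have := opt _ (truth_feasible H); rewrite -subr_le0 objective_excess => ex_le0.
have B := bound s fs.
have [_ _ Hx Hy Hz] := fs.
have Sx := sum_gap_ge0 x px Hx.
have Sy := sum_gap_ge0 y py Hy.
have Sz := sum_gap_ge0 z pz Hz.
have eqx : lp_x s = real_ffun R x by apply: (sum_gap_le0 px Hx); lra.
have eqy : lp_y s = real_ffun R y by apply: (sum_gap_le0 py Hy); lra.
have eqz : lp_z s = real_ffun R z by apply: (sum_gap_le0 pz Hz); lra.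
have ex_ge0 e : 0 <= excess H s e.
  case: e => [[i j] k]; rewrite /excess ffunE /=.
  case: fs => H1 H0 _ _ _.
  case: ifP => h; [have := H1 i j k; rewrite inE|have := H0 i j k; rewrite inE];
    rewrite ?h => /(_ isT); rewrite ?eqx ?eqy ?eqz ?ffunE;
    by case: (x i) (y j) (z k) => [] [] [] [] /=; lra.
have eqw : lp_w s = real_ffun R W.
  have /eqP : \sum_e excess H s e = 0.
    by apply/eqP; rewrite eq_le ex_le0 sumr_ge0.
  rewrite psumr_eq0 // => /allP sum0; apply/ffunP => e.
  have /eqP := sum0 e (mem_index_enum e).
  by rewrite /excess [real_ffun _ _ _]ffunE; case: ifP => _; lra.
by case: s eqx eqy eqz eqw {fs opt ex_le0 B Hx Hy Hz Sx Sy Sz ex_ge0}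
  => ? ? ? ? /= -> -> -> ->.
Qed.
End Recovery.

(** * The slopes are positive with high probability *)

Definition mean_weight (R : realType) (la p : R) own o1 o2 : R :=
  (1 - p) * weight la own o1 o2 true + p * weight la own o1 o2 false.

(** Mean of a slope divided by the number of entries of its slice, when the two
    other vectors have a proportion r of ones. *)
Definition mean_slope (R : realType) (la p r : R) own : R :=
  r * (r * mean_weight la p own true true +
       (1 - r) * mean_weight la p own true false) +
  (1 - r) * (r * mean_weight la p own false true +
             (1 - r) * mean_weight la p own false false).

(** With th = (1 - p) * la, the mean slope at a zero bit is
    r^2 th - p (1 + r + r^2) / 3, and at a one bit it is
    r^2 (1 - 4 p) / 3 - 2 r (1 - r) th.  The first is positive when
    th > p (1 + r + r^2) / (3 r^2), the second when
    th < r (1 - 4 p) / (6 (1 - r)), or 1 - 4 p > 0 if r = 1.  By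
    cross-multiplication, both can hold exactly when D = r^3 - 2 p (1 + r^3) is
    positive. *)
Lemma mean_slopes_positive (R : realType) (p r : R) :
  0 < r <= 1 -> 0 <= p ->
  p < r * r * r / (2 * (1 + r * r * r)) ->
  exists la, 0 <= la <= 1 /\ forall own, 0 < mean_slope la p r own.
Proof.
move=> /andP[r_gt0 r_le1] p_ge0.
have r3 : 0 < r * r * r by rewrite !mulr_gt0.
rewrite ltr_pdivlMr; last by lra.
move=> p_lt; pose D := r * r * r - 2 * p * (1 + r * r * r).
have D_gt0 : 0 < D by rewrite /D; lra.
have pr3 : 0 <= p * (r * r * r) by rewrite mulr_ge0 // ltW.
have r2_le1 : r * r <= 1 by rewrite mulr_ile1 // ltW.
have r3_le1 : r * r * r <= 1 by rewrite mulr_ile1 ?mulr_ge0 // ltW.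
have p_lt4 : p < 4^-1 by nra.
(* The lower bound on th, plus a margin D / 6 small enough for the upper one
   and for la <= 1. *)
pose th := p * (1 + r + r * r) / (3 * (r * r)) + D / 6.
have r2 : 0 < r * r by rewrite mulr_gt0.
have q_gt0 : 0 < 1 - p by lra.
exists (th / (1 - p)); split.
  apply/andP; split.
    rewrite divr_ge0 ?(ltW q_gt0) // addr_ge0 ?divr_ge0 ?mulr_ge0 //; nra.
  rewrite ler_pdivrMr // mul1r /th.
  have : p * (1 + r + r * r) / (3 * (r * r)) <= 2^-1.
    rewrite ler_pdivrMr; last by lra.
    have : p <= r * r * r / 2 by lra.
    have : r * r * r <= r * r by rewrite ler_piMr // ltW.
    have : p * r <= p by rewrite ler_piMr.
    have : p * (r * r) <= p by rewrite ler_piMr.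
    lra.
  by rewrite /D; lra.
have thE : (1 - p) * (th / (1 - p)) = th by field; rewrite gt_eqF.
case; rewrite /mean_slope /mean_weight /= ?mulrN ?thE ?mulr0 ?add0r.
  have -> : r * (r * ((1 - p) * 3^-1 + - (p * 1)) + (1 - r) * (- th + 0)) +
    (1 - r) * (r * (- th + 0) + (1 - r) * 0) =
    D / (3 * r) * (1 - r * r * (1 - r)).
    by rewrite /th /D; field; rewrite gt_eqF.
  rewrite mulr_gt0 ?divr_gt0 ?mulr_gt0 //.
  have : r * r * (1 - r) <= 1 - r by rewrite ler_piMl //; lra.
  lra.
have -> : r * (r * (th + - (p * 1)) + (1 - r) * - (p / 2)) +
    (1 - r) * (r * - (p / 2) + (1 - r) * - (p / 3)) = r * r * D / 6.
  by rewrite /th /D; field; rewrite gt_eqF.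
by rewrite divr_gt0 ?mulr_gt0.
Qed.

Section SlopeTails.
Variables (R : realType) (n m l : nat).
Variables (x : vec bool n) (y : vec bool m) (z : vec bool l) (la p r c : R).
Hypotheses (p_ge0 : 0 <= p) (p_le1 : p <= 1) (la01 : 0 <= la <= 1).
Hypothesis (c01 : 0 <= c <= 1).
Hypothesis (c_mean : forall own, c <= mean_slope la p r own).
Hypotheses (rx : ratio_ones R x = r) (ry : ratio_ones R y = r).
Hypothesis (rz : ratio_ones R z = r).
Implicit Types (G : tensor bool n m l).

Local Notation W := (ground_truth x y z).

Lemma sum_mean_weight a b (u : vec bool a) (v : vec bool b) own :
  ratio_ones R u = r -> ratio_ones R v = r ->
  \sum_i \sum_j mean_weight la p own (u i) (v j) =
  (a * b)%:R * mean_slope la p r own.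
Proof.
move=> ru rv.
pose f o1 := r * mean_weight la p own o1 true +
  (1 - r) * mean_weight la p own o1 false.
under eq_bigr => i _ do rewrite (sum_by_ratio v) rv -/(f (u i)).
rewrite -mulr_sumr (sum_by_ratio u f) ru natrM.
rewrite /mean_slope -/(f true) -/(f false).
by ring.
Qed.

(** Common form of the three tail bounds below: [P] is a slice, with [N]
    entries. *)
Lemma slope_tail (P : pred (entry n m l)) own o1 o2 (N : nat)
    (slope : tensor bool n m l -> R) :
  (forall G,
    slope G = \sum_(e | P e) weight la own (o1 e) (o2 e) (G e == W e)) ->
  N%:R = \sum_(e | P e) (1 : R) ->
  \sum_(e | P e) mean_weight la p own (o1 e) (o2 e) =
    N%:R * mean_slope la p r own ->
  \sum_(G | slope G <= 0) fully_random_mass p W G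
    <= expR (- (c ^+ 2 / 8 * N%:R)).
Proof.
move=> slopeE NE meanE.
have cardP : #|P|%:R = N%:R :> R by rewrite NE sumr_const.
rewrite -cardP (eq_bigl (fun G : tensor bool n m l =>
  \sum_(e | P e) weight la own (o1 e) (o2 e) (G e == W e) <= 0)); last first.
  by move=> G; rewrite slopeE.
apply: (@product_chernoff _ _ _ _ p_ge0 p_le1 P
  (fun e => weight la own (o1 e) (o2 e))) => //.
  by move=> e b; apply: weight_bounded.
by rewrite [leRHS]meanE cardP mulrC ler_wpM2l.
Qed.

Lemma slope_x_tail i :
  \sum_(G | slope_x x y z la G i <= 0) fully_random_mass p W G
    <= expR (- (c ^+ 2 / 8 * (m * l)%:R)).
Proof.
apply: (@slope_tail (fun e => e.1.1 == i) (x i)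
  (fun e => y e.1.2) (fun e => z e.2)).
- move=> G; rewrite /slope_x.
  by rewrite (sum_slice_x (fun e =>
    weight la (x i) (y e.1.2) (z e.2) (G e == W e))).
- rewrite (sum_slice_x (fun=> 1)) !(sumr_const, card_ord) -mulrnA.
  by rewrite mulnC.
- by rewrite (sum_slice_x (fun e => mean_weight _ _ _ (y e.1.2) (z e.2)))
    sum_mean_weight.
Qed.

Lemma slope_y_tail j :
  \sum_(G | slope_y x y z la G j <= 0) fully_random_mass p W G
    <= expR (- (c ^+ 2 / 8 * (n * l)%:R)).
Proof.
apply: (@slope_tail (fun e => e.1.2 == j) (y j)
  (fun e => x e.1.1) (fun e => z e.2)).
- move=> G; rewrite /slope_y.
  by rewrite (sum_slice_y (fun e =>
    weight la (y j) (x e.1.1) (z e.2) (G e == W e))).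
- rewrite (sum_slice_y (fun=> 1)) !(sumr_const, card_ord) -mulrnA.
  by rewrite mulnC.
- by rewrite (sum_slice_y (fun e => mean_weight _ _ _ (x e.1.1) (z e.2)))
    sum_mean_weight.
Qed.

Lemma slope_z_tail k :
  \sum_(G | slope_z x y z la G k <= 0) fully_random_mass p W G
    <= expR (- (c ^+ 2 / 8 * (n * m)%:R)).
Proof.
apply: (@slope_tail (fun e => e.2 == k) (z k)
  (fun e => x e.1.1) (fun e => y e.1.2)).
- move=> G; rewrite /slope_z.
  by rewrite (sum_slice_z (fun e =>
    weight la (z k) (x e.1.1) (y e.1.2) (G e == W e))).
- rewrite (sum_slice_z (fun=> 1)) !(sumr_const, card_ord) -mulrnA.
  by rewrite mulnC.
- by rewrite (sum_slice_z (fun e => mean_weight _ _ _ (x e.1.1) (y e.1.2)))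
    sum_mean_weight.
Qed.

Lemma semi_random_prob_complement (A : adversary n m l) E :
  semi_random_prob p W A E =
  1 - \sum_(G | ~~ `[< E (revert W G (A G)) >]) fully_random_mass p W G.
Proof.
rewrite -(mass_total W p) /semi_random_prob /fully_random_mass.
by rewrite [in RHS](bigID (fun G => `[< E (revert W G (A G)) >])) /= addrK.
Qed.

(** [positive_slopes_recover] applies with the slopes of the tensor before
    reversal, because [revert] only replaces entries by their true values. *)
Lemma recovery_prob (A : adversary n m l) :
  1 - (n%:R * expR (- (c ^+ 2 / 8 * (m * l)%:R)) +
       m%:R * expR (- (c ^+ 2 / 8 * (n * l)%:R)) +
       l%:R * expR (- (c ^+ 2 / 8 * (n * m)%:R))) <=
  semi_random_prob p W A (sLP_recovers R x y z) <= 1.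
Proof.
have mu_ge0 G : 0 <= fully_random_mass p W G by exact: mass_ge0.
rewrite semi_random_prob_complement; apply/andP; split; last first.
  by rewrite gerBl sumr_ge0.
rewrite lerD2l lerN2.
pose B (i : 'I_n + 'I_m + 'I_l) (G : tensor bool n m l) : bool :=
  match i with
  | inl (inl i) => slope_x x y z la G i <= 0
  | inl (inr j) => slope_y x y z la G j <= 0
  | inr k => slope_z x y z la G k <= 0
  end.
pose b (i : 'I_n + 'I_m + 'I_l) : R :=
  match i with
  | inl (inl _) => expR (- (c ^+ 2 / 8 * (m * l)%:R))
  | inl (inr _) => expR (- (c ^+ 2 / 8 * (n * l)%:R))
  | inr _ => expR (- (c ^+ 2 / 8 * (n * m)%:R))
  end.
apply: (@le_trans _ _ (\sum_i b i)); last first.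
  by rewrite !big_sumType /= !sumr_const !card_ord !mulr_natl.
apply: (union_bound (B := B)) => // [G /negP nrec|[[i|j]|k]]; last first.
- exact: slope_z_tail.
- exact: slope_y_tail.
- exact: slope_x_tail.
apply: contrapT => noB; apply: nrec; apply/asboolP.
apply: (@positive_slopes_recover _ _ _ _ _ _ _ la G) => //.
  split=> i; rewrite ltNge; apply/negP => le0; apply: noB.
  - by exists (inl (inl i)).
  - by exists (inl (inr i)).
  - by exists (inr i).
by move=> e; rewrite ffunE; case: ifP; [right|left].
Qed.
End SlopeTails.

(** * Passage to the limit *)

Lemma ratio_ones_le1 (R : realType) n (x : vec bool n) : ratio_ones R x <= 1.
Proof.
case: n x => [|n] x; rewrite /ratio_ones; first by rewrite invr0 mulr0.
rewrite ler_pdivrMr ?ltr0Sn // mul1r ler_nat.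
by rewrite -[leqRHS]card_ord; exact: max_card.
Qed.

Local Open Scope classical_set_scope.

(** Eventually de * d t >= 1, so that the exponent is at most - b t. *)
Lemma cvg_union_bound (R : realType) (a b d : nat -> nat) (de : R) : 0 < de ->
  d @ \oo --> \oo ->
  (a t)%:R * expR (- (b t)%:R) @[t --> \oo] --> (0 : R) ->
  (a t)%:R * expR (- (de * (b t * d t)%:R)) @[t --> \oo] --> (0 : R).
Proof.
move=> de_gt0 /cvgnyPge d_oo ab0.
apply: (squeeze_cvgr _ (cvg_cst (0 : R)) ab0).
have := d_oo (Num.truncn de^-1).+1; apply: filterS => t large.
rewrite mulr_ge0 ?expR_ge0 //= ler_wpM2l // ler_expR lerN2 natrM mulrCA.
rewrite ler_peMr // mulrC -ler_pdivrMr // mul1r.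
by rewrite (le_trans (ltW (truncnS_gt _))) // ler_nat.
Qed.

Theorem corollary1 (R : realType)
  (n m l : nat -> nat)
  (x : forall t, vec bool (n t))
  (y : forall t, vec bool (m t))
  (z : forall t, vec bool (l t))
  (A : forall t, adversary (n t) (m t) (l t))
  (p rx ry rz : R) :
  n @ \oo --> \oo -> m @ \oo --> \oo -> l @ \oo --> \oo ->
  (forall t, monotone_adversary (ground_truth (x t) (y t) (z t)) (A t)) ->
  0 < rx -> 0 < ry -> 0 < rz ->
  (forall t, ratio_ones R (x t) = rx) ->
  (forall t, ratio_ones R (y t) = ry) ->
  (forall t, ratio_ones R (z t) = rz) ->
  rx = ry -> ry = rz ->
  (n t)%:R * expR (- (m t)%:R) @[t --> \oo] --> (0 : R) ->
  (n t)%:R * expR (- (l t)%:R) @[t --> \oo] --> (0 : R) ->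
  (m t)%:R * expR (- (n t)%:R) @[t --> \oo] --> (0 : R) ->
  (m t)%:R * expR (- (l t)%:R) @[t --> \oo] --> (0 : R) ->
  (l t)%:R * expR (- (n t)%:R) @[t --> \oo] --> (0 : R) ->
  (l t)%:R * expR (- (m t)%:R) @[t --> \oo] --> (0 : R) ->
  0 <= p <= 1 ->
  let rw := rx * ry * rz in
  p < rw / (2 * (1 + rw)) ->
  semi_random_prob p (ground_truth (x t) (y t) (z t)) (A t)
      (sLP_recovers R (x t) (y t) (z t)) @[t --> \oo] --> (1 : R).
Proof.
move=> _ m_oo l_oo _ r_gt0 _ _ xr yr zr rxy ryz nm _ mn _ ln _.
move=> /andP[p_ge0 p_le1].
move: ryz rxy r_gt0 xr yr zr => <- <- {ry rz} r_gt0 xr yr zr /= p_lt.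
have r_le1 : rx <= 1 by rewrite -(xr 0%N) ratio_ones_le1.
have r01 : 0 < rx <= 1 by rewrite r_gt0.
have [la [la01 mean_gt0]] := mean_slopes_positive r01 p_ge0 p_lt.
pose c := Num.min 1
  (Num.min (mean_slope la p rx true) (mean_slope la p rx false)).
have c_gt0 : 0 < c by rewrite !lt_min ltr01 !mean_gt0.
have c01 : 0 <= c <= 1 by rewrite ltW //= ge_min lexx.
have c_mean own : c <= mean_slope la p rx own.
  by rewrite /c; case: own; rewrite !ge_min lexx !orbT.
pose de := c ^+ 2 / 8.
have de_gt0 : 0 < de by rewrite divr_gt0 ?exprn_gt0.
pose err t : R := (n t)%:R * expR (- (de * (m t * l t)%:R)) +
  (m t)%:R * expR (- (de * (n t * l t)%:R)) +
  (l t)%:R * expR (- (de * (n t * m t)%:R)).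
have err0 : err t @[t --> \oo] --> (0 : R).
  rewrite -[0 : R]addr0 -[0 in X in X + _]addr0.
  by apply: cvgD; [apply: cvgD|]; apply: cvg_union_bound.
apply: (@squeeze_cvgr _ _ _ _ (fun t => 1 - err t) (fun=> 1)).
- apply: nearW => t.
  exact: (recovery_prob p_ge0 p_le1 la01 c01 c_mean (xr t) (yr t) (zr t)).
- by rewrite -[X in _ --> X]subr0; apply: cvgB => //; exact: cvg_cst.
- exact: cvg_cst.
Qed.
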